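(* For every integer $n \geqslant 3$, the rank of the monoid $\mathrm{wEnd}\,\vec{P}_n$ is $n-1$.
   Context: $\vec{P}_n$ denotes the directed path with vertex set $\{1,\ldots,n\}$ and edge set $E=\{(i,i+1) : i=1,\ldots,n-1\}$. A weak endomorphism of $\vec{P}_n$ is a map $\alpha:\{1,\ldots,n\}\to\{1,\ldots,n\}$ such that, for all vertices $u,v$, if $(u,v)\in E$ and $u\alpha\neq v\alpha$ then $(u\alpha,v\alpha)\in E$ (maps are written on the right of their arguments). $\mathrm{wEnd}\,\vec{P}_n$ denotes the monoid of all weak endomorphisms of $\vec{P}_n$ under composition of maps. The rank of a monoid is the least number of elements in a set generating it as a monoid (the identity is regarded as the empty product). *)

(* Defs.v *)
From HB Require Import structures.
From mathcomp Require Import all_boot.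

Set Implicit Arguments.
Unset Strict Implicit.
Unset Printing Implicit Defensive.

#[short(type="finMonoidType")]
HB.structure Definition FinMonoid := {M of monoid.Monoid M & Finite M}.

Section Rank.
Variable M : finMonoidType.

(* The empty product is 1, so A need not contain the identity. *)
Definition generates (A : {set M}) : Prop :=
  forall x : M, exists2 s : seq M, {subset s <= A} & x = (\prod_(y <- s) y)%g.

Definition has_rank (k : nat) : Prop :=
  (exists2 A : {set M}, generates A & #|A| = k) /\
  (forall A : {set M}, generates A -> k <= #|A|).

End Rank.

Arguments generates {M} A.
Arguments has_rank M k : clear implicits.

Section WeakEndomorphisms.
Variables (V : finType) (e : rel V).

Definition weak_endo (f : {ffun V -> V}) : bool :=
  [forall u, forall v, e u v && (f u != f v) ==> e (f u) (f v)].

Record wEnd := WEnd { wend_fun :> {ffun V -> V}; _ : weak_endo wend_fun }.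

HB.instance Definition _ := [isSub for wend_fun].
HB.instance Definition _ := [Finite of wEnd by <:].

Lemma weak_endoP (f : {ffun V -> V}) :
  reflect (forall u v, e u v -> f u <> f v -> e (f u) (f v)) (weak_endo f).
Proof.
apply: (iffP forallP) => [H u v euv /eqP fuv | H u].
  by have /forallP/(_ v)/implyP := H u; apply; rewrite euv.
by apply/forallP => v; apply/implyP => /andP[euv /eqP]; apply: H.
Qed.

Lemma weak_endo_id : weak_endo [ffun x => x].
Proof. by apply/weak_endoP => u v; rewrite !ffunE. Qed.

(* Maps act on the right: first f, then g. *)
Lemma weak_endo_comp (f g : wEnd) : weak_endo [ffun x => g (f x)].
Proof.
case: f g => [f /weak_endoP Hf] [g /weak_endoP Hg] /=.
apply/weak_endoP => u v euv; rewrite !ffunE => gfuv.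
by apply: (Hg) (gfuv); apply: Hf => // fuv; apply: gfuv; rewrite fuv.
Qed.

Definition wend_one : wEnd := WEnd weak_endo_id.
Definition wend_mul (f g : wEnd) : wEnd := WEnd (weak_endo_comp f g).

Lemma wend_mulA : associative wend_mul.
Proof. by move=> f g h; apply/val_inj/ffunP => x; rewrite !ffunE. Qed.

Lemma wend_1mul : left_id wend_one wend_mul.
Proof. by move=> f; apply/val_inj/ffunP => x; rewrite !ffunE. Qed.

Lemma wend_mul1 : right_id wend_one wend_mul.
Proof. by move=> f; apply/val_inj/ffunP => x; rewrite !ffunE. Qed.

HB.instance Definition _ :=
  isMonoid.Build wEnd wend_mulA wend_1mul wend_mul1.

End WeakEndomorphisms.

(* The vertices 1, ..., n are shifted to 0, ..., n-1. *)
Definition dpath (n : nat) : rel 'I_n := [rel i j : 'I_n | i.+1 == j].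
Arguments dpath n : clear implicits.

(* Main.v *)
Require Import Defs.
From mathcomp Require Import all_boot zify.

(** A weak endomorphism of the path on [0, ..., m] is a map that moves by 0 or
    1 at each step; it is the identity as soon as it moves at every step.  It
    thus matters where such a map stays put, that is, which edges [i -> i.+1]
    it collapses.

    Lower bound.  If a product collapses exactly one edge [i], its first
    non-identity factor collapses some edge, and every edge collapsed by this
    factor is collapsed by the product; so this factor collapses exactly [i]
    as well ([collapsed_factor]).  For each of the [m] edges there is a map
    that collapses only that edge, so a generating set has at least [m]
    elements.

    Upper bound.  The maps that collapse exactly the edge [i] are
    [fold i false], with image [0, ..., m.-1], and [fold i true], with image
    [1, ..., m].  A map [f] that collapses [i] factors through the quotient of
    the path by [i], which is a path with one vertex fewer.  The quotient sits
    in the path as the image of either fold, and the induced map can be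
    extended to the one missing vertex by a step that moves, above the top of
    the image of [f] or below its bottom, wherever there is room.  The
    extension covers one more vertex than [f], so by induction the folds
    generate ([fold_factor], [folds_generate]).  Finally
    one fold for each edge is enough: [fold m.-1 true] shifts [0, ..., m.-1]
    up, [fold 0 false] shifts [1, ..., m] down, and these two turn the folds
    of any edge into each other.  They are folds of distinct edges since
    [m >= 2]. *)

Set Implicit Arguments.
Unset Strict Implicit.
Unset Printing Implicit Defensive.

(** * Products of elements of a set *)

Section GeneratedElements.
Variables (M : finMonoidType) (A : {set M}).

Definition generated (x : M) : Prop :=
  exists2 s : seq M, {subset s <= A} & x = (\prod_(y <- s) y)%g.

Lemma generated1 : generated 1%g.
Proof. by exists [::]; rewrite ?big_nil. Qed.

Lemma generated_mem x : x \in A -> generated x.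
Proof.
move=> Ax; exists [:: x]; last by rewrite big_seq1.
by move=> y; rewrite inE => /eqP->.
Qed.

Lemma generatedM x y : generated x -> generated y -> generated (x * y)%g.
Proof.
move=> [s sA ->] [t tA ->]; exists (s ++ t); last by rewrite big_cat.
by move=> z; rewrite mem_cat => /orP[/sA | /tA].
Qed.

End GeneratedElements.

Section Path.
Variable m : nat.
Notation W := (wEnd (dpath m.+1)).

(** * Weak endomorphisms as functions on natural numbers *)

(** Meaningful for [k <= m] only. *)
Definition ev (f : W) (k : nat) : nat := f (inord k).

Lemma ev_max f k : ev f k <= m.
Proof. by rewrite -ltnS ltn_ord. Qed.

Lemma ev_step f k : k < m -> ev f k.+1 = ev f k \/ ev f k.+1 = (ev f k).+1.
Proof.
move=> ltkm; case: f => f wf; rewrite /ev /=.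
have [->|/eqP neq] := eqVneq (f (inord k.+1)) (f (inord k)); first by left.
right; apply/esym/eqP; have /weak_endoP := wf; apply; last by move=> /esym.
by rewrite /dpath /= !inordK // ltnS ltnW.
Qed.

Lemma evM f g k : ev (f * g)%g k = ev g (ev f k).
Proof. by rewrite /ev /= ffunE inord_val. Qed.

Lemma ev1 k : k <= m -> ev 1%g k = k.
Proof. by move=> lekm; rewrite /ev /= ffunE inordK. Qed.

Lemma ev_ext f g : (forall k, k <= m -> ev f k = ev g k) -> f = g.
Proof.
move=> efg; apply/val_inj/ffunP => x; apply: val_inj.
by have := efg x; rewrite /ev inord_val; apply; rewrite -ltnS.
Qed.

Lemma ev_homo f k l : k <= l <= m -> ev f k <= ev f l <= ev f k + (l - k).
Proof.
elim: l => [|l IHl] /andP[kl lm]; first by rewrite (_ : k = 0); lia.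
have [->|neq] := eqVneq k l.+1; first lia.
have klm : k <= l <= m by lia.
by have [] := ev_step f lm; have := IHl klm; lia.
Qed.

Definition path_step (p : nat -> nat) : Prop :=
  (forall k, k <= m -> p k <= m) /\
  (forall k, k < m -> p k.+1 = p k \/ p k.+1 = (p k).+1).

(** The default value [1] is used only when [p] is not a [path_step]. *)
Definition wend_of (p : nat -> nat) : W :=
  insubd (1%g : W) [ffun x : 'I_m.+1 => inord (p x)].

Lemma ev_wend_of p k : path_step p -> k <= m -> ev (wend_of p) k = p k.
Proof.
move=> [pm pS] km; rewrite /ev /wend_of.
have wp : weak_endo (dpath m.+1) [ffun x : 'I_m.+1 => inord (p x)].
  apply/weak_endoP => u v; rewrite !ffunE /dpath /= => /eqP uv.
  have vm : u < m by rewrite -ltnS uv ltn_ord.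
  rewrite -uv !inordK ?ltnS ?pm ?(ltnW vm) //.
  by have [->|->] := pS u vm.
have -> : wend_fun (insubd (1%g : W) [ffun x : 'I_m.+1 => inord (p x)])
          = [ffun x : 'I_m.+1 => inord (p x)].
  exact: (insubdK (sT := W) (1%g : W) wp).
by rewrite ffunE !inordK ?ltnS ?pm.
Qed.

(** * Collapsed edges *)

Definition collapsed (f : W) : {set 'I_m} := [set i : 'I_m | ev f i.+1 == ev f i].

Lemma collapsed1 : collapsed 1%g = set0.
Proof.
by apply/setP => i; rewrite !inE !ev1 ?(ltnW (ltn_ord i)) //; have := ltn_ord i; lia.
Qed.

(** A map that moves at each of the [m] steps has no room to start above 0. *)
Lemma collapsed_eq0 f : collapsed f = set0 -> f = 1%g.
Proof.
move=> f0; have evD k : k <= m -> ev f k = ev f 0 + k.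
  elim: k => [|k IHk] km; first by rewrite addn0.
  have [|] := ev_step f km; last by rewrite IHk; lia.
  by move/eqP; have := in_set0 (Ordinal km); rewrite -f0 inE /= => ->.
by apply: ev_ext => k km; rewrite ev1 // evD //; have := evD m; have := ev_max f m; lia.
Qed.

Lemma collapsedMl f g : collapsed f \subset collapsed (f * g)%g.
Proof. by apply/subsetP => i; rewrite !inE !evM => /eqP->. Qed.

(** An edge collapsed alone by a product is collapsed alone by the first
    factor different from the identity. *)
Lemma collapsed_factor (A : {set W}) (i : 'I_m) f :
  generated A f -> collapsed f = [set i] -> [set i] \in [set collapsed y | y in A].
Proof.
move=> [s sA ->]; elim: s sA => [|y s IHs] sA.
  by rewrite big_nil collapsed1 => /setP/(_ i); rewrite !inE eqxx.
rewrite big_cons => fi; have := collapsedMl y (\prod_(z <- s) z)%g.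
rewrite fi subset1 => /orP[/eqP <-|/eqP /collapsed_eq0 y1].
  by apply: imset_f; rewrite sA ?mem_head.
apply: IHs; first by move=> z zs; rewrite sA // inE zs orbT.
by rewrite -fi y1 mul1g.
Qed.

(** * Folds *)

Definition fold (i : nat) (a : bool) : W := wend_of (fun k => unbump i k + a).

Lemma ev_fold i a k : i < m -> k <= m -> ev (fold i a) k = unbump i k + a.
Proof.
move=> im km; rewrite ev_wend_of // /unbump; split=> [l|l] lm.
  by case: a; lia.
by case: (ltngtP i l); lia.
Qed.

Lemma collapsed_fold (i : 'I_m) a : collapsed (fold i a) = [set i].
Proof.
apply/setP => j; rewrite !inE -val_eqE /=.
have [im jm] := (ltn_ord i, ltn_ord j).
by rewrite !ev_fold ?(ltnW jm) // /unbump; lia.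
Qed.

(** The map induced by [f] on the quotient by the edge [i] is
    [ev f \o bump i.+1]; it is extended upwards when [f] misses the vertex
    [m], and downwards otherwise.  In the latter case [f] misses 0, as it
    collapses an edge. *)
Lemma fold_factor f (i : 'I_m) : i \in collapsed f ->
  exists a h, f = (fold i a * h)%g /\ ev f m - ev f 0 < ev h m - ev h 0.
Proof.
rewrite inE => /eqP fi; have im := ltn_ord i.
have le_f0m := ev_homo f (k := 0) (l := m) ltac:(lia).
have fbS k : k.+1 < m -> ev f (bump i.+1 k.+1) = ev f (bump i.+1 k) \/
                      ev f (bump i.+1 k.+1) = (ev f (bump i.+1 k)).+1.
  move=> km; have [ki|ki|ki] := ltngtP k i.
  - have -> : bump i.+1 k.+1 = k.+1 by rewrite /bump; lia.
    have -> : bump i.+1 k = k by rewrite /bump; lia.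
    by apply: ev_step; lia.
  - have -> : bump i.+1 k.+1 = k.+2 by rewrite /bump; lia.
    have -> : bump i.+1 k = k.+1 by rewrite /bump; lia.
    exact: ev_step.
  - have -> : bump i.+1 k.+1 = i.+2 by rewrite /bump; lia.
    have -> : bump i.+1 k = i by rewrite /bump; lia.
    (* [bump] jumps over [i.+1], whose image under [f] is that of [i] *)
    by rewrite -fi; apply: ev_step; lia.
have fb0 : ev f (bump i.+1 0) = ev f 0 by [].
have fbm : ev f (bump i.+1 m.-1) = ev f m.
  have [e|ne] := eqVneq (nat_of_ord i) m.-1.
    have -> : bump i.+1 m.-1 = i by rewrite /bump; lia.
    by rewrite -fi; congr (ev f _); lia.
  by congr (ev f _); rewrite /bump; lia.
have bK k : k <= m -> ev f (bump i.+1 (unbump i k)) = ev f k.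
  move=> km; have [e|ne] := eqVneq k i.+1.
    by rewrite e [RHS]fi; congr (ev f _); rewrite /bump /unbump; lia.
  by congr (ev f _); rewrite /bump /unbump; case: (ltnP i k); lia.
have ubm k : k <= m -> unbump i k < m by rewrite /unbump; lia.
have [fm|fm] := ltnP (ev f m) m.
  pose p k := if k == m then (ev f m).+1 else ev f (bump i.+1 k).
  have pP : path_step p.
    split=> k km; rewrite /p.
      by case: eqP => // _; exact: ev_max.
    have [e|ne] := eqVneq k.+1 m; last first.
      by rewrite ifN; [apply: fbS; lia | lia].
    have ek : k = m.-1 by lia.
    by rewrite ifN; [rewrite ek fbm; right | lia].
  exists false, (wend_of p); split.
    apply: ev_ext => k km.
    rewrite evM ev_fold // addn0 ev_wend_of ?(ltnW (ubm k km)) // /p.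
    by rewrite ifN ?bK //; have := ubm k km; lia.
  rewrite !ev_wend_of // /p eqxx ifN; last by lia.
  by rewrite fb0; lia.
have f0 : 0 < ev f 0.
  have := ev_homo f (k := 0) (l := i) ltac:(lia).
  by have := ev_homo f (k := i.+1) (l := m) ltac:(lia); lia.
pose p k := if k is k'.+1 then ev f (bump i.+1 k') else (ev f 0).-1.
have pP : path_step p.
  split=> [[|k]|[|k]] km; rewrite /p.
  - by have := ev_max f 0; lia.
  - exact: ev_max.
  - by rewrite fb0; lia.
  - exact: fbS.
exists true, (wend_of p); split.
  apply: ev_ext => k km; rewrite evM ev_fold // addn1.
  by rewrite ev_wend_of ?ubm //= bK.
rewrite !ev_wend_of //=.
have pE k : 0 < k -> p k = ev f (bump i.+1 k.-1) by case: k.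
rewrite pE ?fbm; last by lia.
by lia.
Qed.

Lemma folds_generate (A : {set W}) :
  (forall (i : 'I_m) a, generated A (fold i a)) -> generates A.
Proof.
move=> genA f; have [d] := ubnP (m - (ev f m - ev f 0)).
elim: d f => // d IHd f fd; have [/collapsed_eq0 ->|[i fi]] := set_0Vmem (collapsed f).
  exact: generated1.
have [a [h [fE hf]]] := fold_factor fi.
rewrite fE; apply: generatedM; first exact: genA.
apply: IHd; have := ev_max h m; lia.
Qed.

(** * A generating set of least size *)

(** The upper fold is taken at the last edge only: the last edge gives the
    shift upwards and the edge 0 gives the shift downwards. *)
Definition basic_fold (i : 'I_m) : W := fold i (val i == m.-1).

Lemma basic_fold_inj : injective basic_fold.
Proof.
by move=> i j /(congr1 collapsed); rewrite !collapsed_fold => /set1_inj.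
Qed.

Lemma fold_shift_up i : i < m -> fold i true = (fold i false * fold m.-1 true)%g.
Proof.
move=> im; apply: ev_ext => k km; have ub : unbump i k < m by rewrite /unbump; lia.
by rewrite evM !ev_fold ?addn0 //; rewrite /unbump in ub *; lia.
Qed.

Lemma fold_shift_down i : i < m -> fold i false = (fold i true * fold 0 false)%g.
Proof.
move=> im; apply: ev_ext => k km; have ub : unbump i k < m by rewrite /unbump; lia.
by rewrite evM !ev_fold ?addn0 //; rewrite /unbump in ub *; lia.
Qed.

Lemma basic_folds_generate : 1 < m -> generates [set basic_fold i | i : 'I_m].
Proof.
move=> m1; set A := imset _ _; apply: folds_generate.
have low i : i < m.-1 -> generated A (fold i false).
  move=> im; have im' : i < m by lia.
  apply/generated_mem/imsetP; exists (Ordinal im') => //.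
  by rewrite /basic_fold /= ltn_eqF.
have up : generated A (fold m.-1 true).
  have mm : m.-1 < m by lia.
  by apply/generated_mem/imsetP; exists (Ordinal mm); rewrite /basic_fold ?eqxx.
have all_low i : i < m -> generated A (fold i false).
  move=> im; have [/low //|mi] := ltnP i m.-1.
  have -> : i = m.-1 by lia.
  rewrite fold_shift_down; last by lia.
  by apply: generatedM => //; apply: low; lia.
move=> i [|]; last exact: all_low.
by rewrite fold_shift_up //; apply: generatedM; first exact: all_low.
Qed.

Lemma leq_card_generates (A : {set W}) : generates A -> m <= #|A|.
Proof.
move=> genA; rewrite -[m in m <= _]card_ord -(card_imset _ (@set1_inj 'I_m)).
apply: leq_trans (leq_imset_card collapsed A).
apply/subset_leq_card/subsetP => _ /imsetP[i _ ->].
exact: collapsed_factor (genA (fold i false)) (collapsed_fold i false).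
Qed.

End Path.

Theorem theorem2p5 (n : nat) (hn : 3 <= n) :
  has_rank (wEnd (dpath n)) (n - 1).
Proof.
case: n hn => // m m1; rewrite subn1 /=; split; last exact: leq_card_generates.
exists [set basic_fold i | i : 'I_m]; first exact: basic_folds_generate.
by rewrite card_imset ?card_ord //; apply: basic_fold_inj.
Qed.
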